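(* Let $F, A\in\mathbb{R}^{n\times n}$ be generic matrices defining the structural descriptor system $F\dot{x}(t)=Ax(t)+Bu(t)$, and assume it is solvable, i.e. $\operatorname{rank}(A-sF)=n$ (equivalently $\nu(G_{A-sF})=n$). A subset $S\subseteq V^-$ is an input configuration if and only if there exist a maximum matching $M$ of $G_A$ and a set $C\subseteq V^-$ such that for every maximal consistent DM s-component $G_i$ of $G_{A-sF}$ there is a node $c\in C$ with $G_i \preceq [c]$, and $$ S \supseteq U_M \cup C, \qquad U_M := V^-\setminus \partial^- M, $$ where $[c]$ denotes the DM component of $G_{A-sF}$ containing $c$.
   Context: Notation: $X=\{x_1,\dots,x_n\}$ (variable nodes, one per column), $V^-=\{e_1,\dots,e_n\}$ (equation nodes, one per row). $G_{A-sF}$ is the bipartite graph on $(X,V^-)$ with an edge between $e_i$ and $x_j$ whenever $A_{ij}\ne0$ or $F_{ij}\ne0$; edges coming from nonzero entries of $F$ are called s-arcs. $G_A$ is the bipartite graph on $(X,V^-)$ with an edge $\{e_i,x_j\}$ whenever $A_{ij}\neq 0$. $\nu(\cdot)$ is maximum matching size; for a matching $M$, $\partial^-M$ is the set of nodes of $V^-$ covered by $M$. A matrix is generic if its nonzero entries are algebraically independent free parameters. The system $F\dot x=Ax+Bu$ is structurally controllable if $\operatorname{rank}[A-zF\mid B]=n$ for all $z\in\mathbb{C}$ when the nonzero entries of $F,A,B$ are algebraically independent parameters. Input configuration: for $S\subseteq V^-$, let $B_S$ be the generic $n\times n$ diagonal matrix $\mathrm{diag}(b)$ whose $i$-th diagonal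 entry is a free nonzero parameter if $e_i\in S$ and $0$ otherwise (each input is connected to exactly one equation node). $S$ is an input configuration if the system with $B=B_S$ is structurally controllable. DM decomposition of a bipartite graph $G=(V^+,V^-;E)$ (here $V^+=X$): take a maximum matching $M$; form the auxiliary digraph $\tilde G_M$ on $V^+\cup V^-$ in which each edge not in $M$ is oriented from its $V^+$-end to its $V^-$-end and each edge in $M$ is oriented from its $V^-$-end to its $V^+$-end. Let $V_0$ be the set of nodes reachable in $\tilde G_M$ from $V^+\setminus\partial^+M$, $V_\infty$ the set of nodes from which $V^-\setminus\partial^-M$ is reachable, and let $V_1,\dots,V_b$ be the strongly connected components of $\tilde G_M$ after deleting $V_0\cup V_\infty$. The DM components $G_k$ are the subgraphs of $G$ induced by $V_k$; $G_1,\dots,G_b$ are consistent, $G_0,G_\infty$ inconsistent (this does not depend on the choice of $M$). For consistent components, $G_i\preceq G_j$ iff there is a directed path from (a node of) $G_j$ to (a node of) $G_i$ in $\tilde G_M$; this is a partial order. A consistent DM s-component is a consistent DM component containing an s-arc; it is maximal if no other DM s-component $G_j\neq G_k$ satisfies $G_k\preceq G_j$.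
   Formalization: In the auxiliary digraph, edges of the maximum matching are oriented both ways (not only from V^- to V^+), so that a 1×1 DM block {e_i, x_j} is one component; with the one-way orientation the claim fails for n=1, F=[f], A=[a], S=∅. *)

(* Defs.v *)
From HB Require Import structures.
From mathcomp Require Import all_boot all_order all_algebra.
From mathcomp Require Import reals Rstruct.
From mathcomp Require Import complex.
Set Implicit Arguments. Unset Strict Implicit. Unset Printing Implicit Defensive.
Import Order.TTheory GRing.Theory Num.Theory.
Local Open Scope ring_scope.

Notation Real := Rdefinitions.R.

(* Patterns.  A pattern is a relation P : 'I_n -> 'I_n -> bool, with   *)
(* P i j = true iff the (i,j) entry (row = equation e_i, column =      *)
(* variable x_j) is a nonzero free parameter.                          *)
Definition pattern (n : nat) := 'I_n -> 'I_n -> bool.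

(* Algebraic independence over Q (equivalently over Z) of the          *)
(* subfamily (x k)_{k | P k}: no nonzero integer polynomial in these   *)
(* variables vanishes.  A polynomial is given by integer coefficients  *)
(* c e indexed by exponent vectors e (each exponent < d), supported on *)
(* exponent vectors that vanish outside P.                             *)
Definition alg_indep_on (I : finType) (P : pred I) (x : I -> Real) : Prop :=
  forall (d : nat) (c : {ffun I -> 'I_d} -> int),
    (forall e, c e != 0 -> forall k, ~~ P k -> nat_of_ord (e k) = 0%N) ->
    (exists e, c e != 0) ->
    \sum_(e : {ffun I -> 'I_d}) (c e)%:~R * \prod_(k : I) x k ^+ e k != 0.

Definition param_index (n : nat) := (('I_n * 'I_n) + ('I_n * 'I_n) + 'I_n)%type.

Definition param_family n (Fv Av : 'M[Real]_n) (bv : 'I_n -> Real)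
  : param_index n -> Real :=
  fun k => match k with
           | inl (inl (i, j)) => Fv i j
           | inl (inr (i, j)) => Av i j
           | inr i => bv i
           end.

Definition free_params n (PF PA : pattern n) (S : {set 'I_n})
  : pred (param_index n) :=
  fun k => match k with
           | inl (inl (i, j)) => PF i j
           | inl (inr (i, j)) => PA i j
           | inr i => i \in S
           end.

Definition generic_realization n (PF PA : pattern n) (S : {set 'I_n})
  (Fv Av : 'M[Real]_n) (bv : 'I_n -> Real) : Prop :=
  [/\ forall i j, (Fv i j != 0) = PF i j,
      forall i j, (Av i j != 0) = PA i j,
      forall i, (bv i != 0) = (i \in S) &
      alg_indep_on (free_params PF PA S) (param_family Fv Av bv)].

Definition cplx_mx n m (M : 'M[Real]_(n, m)) : 'M[Real[i]]_(n, m) :=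
  map_mx (fun x : Real => (x%:C)%C) M.

Definition controllable_realization n (Fv Av : 'M[Real]_n) (bv : 'I_n -> Real)
  : Prop :=
  forall z : Real[i],
    \rank (row_mx (cplx_mx Av - z *: cplx_mx Fv)
                  (cplx_mx (diag_mx (\row_i bv i)))) = n.

(* S is an input configuration: the system F x' = A x + B_S u is          *)
(* structurally controllable, i.e. controllable for (every) realization   *)
(* with algebraically independent nonzero entries.                       *)
Definition input_configuration n (PF PA : pattern n) (S : {set 'I_n}) : Prop :=
  forall (Fv Av : 'M[Real]_n) (bv : 'I_n -> Real),
    generic_realization PF PA S Fv Av bv -> controllable_realization Fv Av bv.

(* Bipartite graphs and matchings.  A bipartite graph on (X, V^-) is an *)
(* edge relation E : pattern n with E i j iff {e_i, x_j} is an edge.    *)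
(* A matching is a set of pairs (i, j) (row i, column j).              *)
Definition pencil_graph n (PF PA : pattern n) : pattern n :=
  fun i j => PA i j || PF i j.

Definition is_matching n (E : pattern n) (M : {set 'I_n * 'I_n}) : bool :=
  [forall p in M, E p.1 p.2] &&
  [forall p in M, forall q in M, ((p.1 == q.1) || (p.2 == q.2)) ==> (p == q)].

Definition is_max_matching n (E : pattern n) (M : {set 'I_n * 'I_n}) : Prop :=
  is_matching E M /\
  forall M' : {set 'I_n * 'I_n}, is_matching E M' -> (#|M'| <= #|M|)%N.

Definition nu n (E : pattern n) : nat :=
  \max_(M : {set 'I_n * 'I_n} | is_matching E M) #|M|.

Definition covered_rows n (M : {set 'I_n * 'I_n}) : {set 'I_n} :=
  [set p.1 | p in M].
Definition covered_cols n (M : {set 'I_n * 'I_n}) : {set 'I_n} :=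
  [set p.2 | p in M].

(* DM decomposition w.r.t. a maximum matching M.  Nodes: inl j = x_j    *)
(* (V^+ = X), inr i = e_i (V^-).  Auxiliary digraph: every edge is an   *)
(* arc x_j -> e_i, and every matching edge also gets the arc e_i -> x_j *)
(* (Murota's convention).                                 *)
Definition node n := ('I_n + 'I_n)%type.

Definition aux_arc n (E : pattern n) (M : {set 'I_n * 'I_n}) : rel (node n) :=
  fun u v => match u, v with
             | inl j, inr i => E i j
             | inr i, inl j => (i, j) \in M
             | _, _ => false
             end.

Definition V0 n (E : pattern n) (M : {set 'I_n * 'I_n}) : {set node n} :=
  [set v | [exists j, (j \notin covered_cols M) && connect (aux_arc E M) (inl j) v]].

Definition Vinf n (E : pattern n) (M : {set 'I_n * 'I_n}) : {set node n} :=
  [set v | [exists i, (i \notin covered_rows M) && connect (aux_arc E M) v (inr i)]].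

Definition mid_node n (E : pattern n) (M : {set 'I_n * 'I_n}) (v : node n) : bool :=
  (v \notin V0 E M) && (v \notin Vinf E M).

Definition mid_arc n (E : pattern n) (M : {set 'I_n * 'I_n}) : rel (node n) :=
  fun u v => [&& mid_node E M u, mid_node E M v & aux_arc E M u v].

Definition scc n (E : pattern n) (M : {set 'I_n * 'I_n}) (u : node n) : {set node n} :=
  [set v | [&& mid_node E M v, connect (mid_arc E M) u v & connect (mid_arc E M) v u]].

Definition consistent_comp n (E : pattern n) (M : {set 'I_n * 'I_n})
  (K : {set node n}) : Prop :=
  exists u, mid_node E M u /\ K = scc E M u.

Definition dm_comp n (E : pattern n) (M : {set 'I_n * 'I_n}) (u : node n) : {set node n} :=
  if u \in V0 E M then V0 E M
  else if u \in Vinf E M then Vinf E M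
  else scc E M u.

Definition dm_le n (E : pattern n) (M : {set 'I_n * 'I_n}) (K1 K2 : {set node n}) : Prop :=
  exists u v, [/\ u \in K2, v \in K1 & connect (aux_arc E M) u v].

Definition has_sarc n (PF : pattern n) (K : {set node n}) : bool :=
  [exists i, exists j, [&& PF i j, inr i \in K & inl j \in K]].

Definition s_comp n (PF PA : pattern n) (M : {set 'I_n * 'I_n}) (K : {set node n}) : Prop :=
  consistent_comp (pencil_graph PF PA) M K /\ has_sarc PF K.

Definition maximal_s_comp n (PF PA : pattern n) (M : {set 'I_n * 'I_n})
  (K : {set node n}) : Prop :=
  s_comp PF PA M K /\
  forall K', s_comp PF PA M K' -> K' <> K -> ~ dm_le (pencil_graph PF PA) M K K'.

(* Main.v *)
Require Import Defs.
From Stdlib Require Runcountable.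
From HB Require Import structures.
From mathcomp Require Import all_boot all_order all_algebra all_fingroup.
From mathcomp Require cardinality polyrcf.
From mathcomp Require Import boolp reals Rstruct.
From mathcomp Require Import complex.
Set Implicit Arguments. Unset Strict Implicit. Unset Printing Implicit Defensive.
Import Order.TTheory GRing.Theory Num.Theory.
Local Open Scope ring_scope.

(** Let [E] be the graph of the pencil and [mu] the permutation given by a perfect
    matching.  Identifying [x_j] with [e_(mu j)] turns the auxiliary digraph into a
    relation [reach] on rows, and the condition on [C] says that every s-arc lying inside
    a component is reached from [C].

    The only consequence of genericity that is used: every free parameter is avoided by a
    subfield of the complex numbers that is algebraically closed in them and contains all
    the other parameters.  Expanding a determinant along a column, such a field shows that the
    determinant of a matrix mixing pencil columns and unit columns does not vanish as soon
    as one product in its expansion has generic factors.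

    Sufficiency: let [y] be a left null vector of [A - z F] vanishing on [S].  For [z = 0]
    the matching of [G_A] gives [y = 0].  For [z <> 0], rotating [mu] along a walk from an
    input to column [j] of an s-arc shows that [z] is algebraic over the parameters outside
    column [j]; therefore the entries of column [j] stay generic in [A - z F], which is
    then invertible.

    Necessity: the rank condition at [z = 0] extends the rows outside [S] to a row basis of
    [A], and a nonzero minor gives the matching.  If an s-arc inside a component is not
    reached from [S], the block of the rows reaching it has a nonconstant determinant, and
    a null vector at one of its roots vanishes on [S]. *)

(** * Integer polynomials in an algebraically independent family, over any field *)

Definition alg_indep_in (K : fieldType) (I : finType) (P : pred I) (x : I -> K) :=
  forall (d : nat) (c : {ffun I -> 'I_d} -> int),
    (forall e, c e != 0 -> forall k, ~~ P k -> nat_of_ord (e k) = 0%N) ->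
    (exists e, c e != 0) ->
    \sum_(e : {ffun I -> 'I_d}) (c e)%:~R * \prod_(k : I) x k ^+ e k != 0.

Section IntegerPolynomials.

Variables (K : fieldType) (I : finType) (x : I -> K).

(** Unreduced lists without a degree bound: differences and products become list operations, and
    like monomials are collected only by [terms_coef]. *)
Definition terms := seq (int * {ffun I -> nat}).

Definition monom (m : {ffun I -> nat}) : K := \prod_k x k ^+ m k.

Definition terms_val (s : terms) : K := \sum_(p <- s) p.1%:~R * monom p.2.

Definition terms_on (P : pred I) (s : terms) :=
  forall p, p \in s -> forall k, ~~ P k -> p.2 k = 0%N.

Definition terms_coef (s : terms) (m : {ffun I -> nat}) : int :=
  \sum_(p <- s | p.2 == m) p.1.

Definition int_poly_value (P : pred I) (t : K) :=
  exists2 s, terms_on P s & t = terms_val s.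

(** A finite list has all its exponents below some [d], so the collected coefficients form a
    function of the kind that [alg_indep_in] quantifies over. *)
Lemma terms_coef_eq0 (P : pred I) (s : terms) :
  alg_indep_in P x -> terms_on P s -> terms_val s = 0 ->
  forall m, terms_coef s m = 0.
Proof.
move=> ind sP s0 m; apply/eqP/negPn/negP => cm.
have [d dP] : exists d, forall p, p \in s -> forall k, (p.2 k < d)%N.
  elim: s {sP s0 cm} => [|p s [d dP]]; first by exists 0%N.
  exists (maxn d (\max_k p.2 k).+1) => q; rewrite inE => /orP[/eqP->|qs] k.
    by rewrite leq_max ltnS (leq_bigmax k) orbT.
  by rewrite leq_max dP.
pose nm (e : {ffun I -> 'I_d}) : {ffun I -> nat} := [ffun k => nat_of_ord (e k)].
have nm_inj : injective nm.
  by move=> e f /ffunP ef; apply/ffunP => k; apply: val_inj; have := ef k; rewrite !ffunE.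
have nmS p : p \in s -> exists e, nm e = p.2.
  move=> ps; exists [ffun k => Ordinal (dP p ps k)].
  by apply/ffunP => k; rewrite !ffunE.
have coefN m' : terms_coef s m' != 0 -> exists2 p, p \in s & p.2 = m'.
  move=> c0; apply: contrapT => no; move/eqP: c0; apply.
  rewrite /terms_coef big_seq_cond big1 // => p /andP[ps /eqP pm].
  by case: no; exists p.
suff /eqP[] : \sum_e (terms_coef s (nm e))%:~R * \prod_k x k ^+ e k != 0; last first.
  apply: (ind d (fun e => terms_coef s (nm e))).
  move=> e /coefN [p ps pe] k Pk.
  by have := sP p ps k Pk; rewrite pe ffunE.
  have [p ps pm] := coefN m cm; have [e em] := nmS p ps.
  by exists e; rewrite em pm.
rewrite -[RHS]s0 /terms_val.
under eq_bigr do rewrite /terms_coef rmorph_sum /= mulr_suml.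
rewrite (exchange_big_dep predT) //= big_seq [RHS]big_seq.
apply: eq_bigr => p ps; have [e em] := nmS p ps.
rewrite (big_pred1 e) => [|f /=]; last by rewrite -em eq_sym; apply/eqP/eqP => [/nm_inj|->].
by congr (_ * _); apply: eq_bigr => k _; rewrite -em ffunE.
Qed.

Lemma int_poly_value1 P : int_poly_value P 1.
Proof.
exists [:: (1, [ffun=> 0%N])]; first by move=> p; rewrite inE => /eqP-> k _; rewrite ffunE.
by rewrite /terms_val big_seq1 /= mul1r /monom big1 // => k _; rewrite ffunE.
Qed.

Lemma int_poly_valueX (P : pred I) k : P k -> int_poly_value P (x k).
Proof.
move=> Pk; exists [:: (1, [ffun l => (l == k) : nat])].
  by move=> p; rewrite inE => /eqP-> l /= Pl; rewrite ffunE; case: eqP Pl => // ->; rewrite Pk.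
rewrite /terms_val big_seq1 /= mul1r /monom (bigD1 k) //= ffunE eqxx expr1 big1 ?mulr1 // => l.
by rewrite ffunE => /negbTE->.
Qed.

Lemma int_poly_valueB (P : pred I) a b :
  int_poly_value P a -> int_poly_value P b -> int_poly_value P (a - b).
Proof.
move=> [s sP ->] [t tP ->]; exists (s ++ [seq (- p.1, p.2) | p <- t]).
  move=> p; rewrite mem_cat => /orP[/sP//|/mapP[q qt ->] k Pk /=]; exact: tP Pk.
rewrite /terms_val big_cat big_map /= -sumrN; congr (_ + _).
by apply: eq_bigr => p _; rewrite rmorphN mulNr.
Qed.

Lemma int_poly_valueM (P : pred I) a b :
  int_poly_value P a -> int_poly_value P b -> int_poly_value P (a * b).
Proof.
move=> [s sP ->] [t tP ->].
pose mulT (p q : int * {ffun I -> nat}) : int * {ffun I -> nat} :=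
  (p.1 * q.1, [ffun k => (p.2 k + q.2 k)%N]).
exists [seq mulT p q | p <- s, q <- t].
  move=> _ /allpairsP[[p q] /= [ps qt ->]] k Pk.
  by rewrite /= ffunE (sP p ps k Pk) (tP q qt k Pk).
rewrite /terms_val big_allpairs_dep mulr_suml; apply: eq_bigr => p _.
rewrite mulr_sumr; apply: eq_bigr => q _ /=.
rewrite rmorphM /= mulrACA; congr (_ * _).
by rewrite /monom -big_split; apply: eq_bigr => k _; rewrite ffunE exprD.
Qed.

(** Transcendence of [x k] over the other parameters. Writing the exponent [i] at [k] into the terms
    of [a i] merges the relation into one integer polynomial [S]; monomials coming from different
    [i] cannot cancel there. *)
Lemma indep_int_poly_eq0 (P : pred I) k n (a : nat -> K) :
  P k -> alg_indep_in P x ->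
  (forall i, (i < n)%N -> int_poly_value (predD1 P k) (a i)) ->
  \sum_(i < n) a i * x k ^+ i = 0 -> forall i, (i < n)%N -> a i = 0.
Proof.
move=> Pk ind aP sum0.
have [s sP] : exists s : nat -> terms, forall i, (i < n)%N ->
    terms_on (predD1 P k) (s i) /\ a i = terms_val (s i).
  have /choice [s sP] : forall i, exists t, (i < n)%N ->
      terms_on (predD1 P k) t /\ a i = terms_val t.
    by move=> i; case: ltnP => [/aP[t tP ->]|_]; [exists t | exists [::]].
  by exists s.
pose up i (m : {ffun I -> nat}) : {ffun I -> nat} := [ffun l => if l == k then i else m l].
pose S : terms := flatten [seq [seq (p.1, up i p.2) | p <- s i] | i <- iota 0 n].
have SP : terms_on P S.
  move=> _ /allpairsPdep[i [p [+ ps ->]]] l Pl; rewrite mem_iota /= add0n => /sP[si _].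
  rewrite ffunE; case: eqP Pl => [->|_ Pl]; first by rewrite Pk.
  by apply: (si p ps); rewrite /= negb_and Pl orbT.
have S0 : terms_val S = 0.
  rewrite -sum0 /terms_val big_flatten big_map /=.
  rewrite -[X in iota 0 X]subn0 -/(index_iota 0 n) big_mkord; apply: eq_bigr => i _.
  have [si ->] := sP i (ltn_ord i).
  rewrite big_map /terms_val mulr_suml big_seq [RHS]big_seq; apply: eq_bigr => p ps /=.
  rewrite -mulrA; congr (_ * _); rewrite /monom (bigD1 k) //= [in RHS](bigD1 k) //=.
  have pk : p.2 k = 0%N by apply: (si p ps); rewrite /= eqxx.
  rewrite ffunE eqxx pk expr0 mul1r mulrC; congr (_ * _).
  by apply: eq_bigr => l /negbTE lk; rewrite ffunE lk.
have Sc := terms_coef_eq0 ind SP S0.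
move=> i ilt; have [si ->] := sP i ilt.
have ci (m : {ffun I -> nat}) : m k = 0%N -> terms_coef (s i) m = 0.
  move=> mk; rewrite -[RHS](Sc (up i m)) /terms_coef big_flatten big_map /=.
  rewrite (bigD1_seq i) ?mem_iota ?iota_uniq //= [X in _ + X]big1_seq ?addr0.
    rewrite big_map big_seq_cond [RHS]big_seq_cond; apply: eq_bigl => p /=.
    case ps: (p \in s i) => //=; apply/eqP/eqP => [->//|/ffunP e].
    apply/ffunP => l; have := e l; rewrite !ffunE; case: eqP => // -> _.
    by rewrite mk (si p ps) // /= eqxx.
  move=> j /andP[ji _]; rewrite big_map big1_seq // => p /andP[/eqP/ffunP/(_ k)].
  by rewrite !ffunE eqxx => jj; rewrite jj eqxx in ji.
pose ms := undup [seq p.2 | p <- s i].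
have -> : terms_val (s i) = \sum_(m <- ms) (terms_coef (s i) m)%:~R * monom m.
  rewrite /terms_coef; under eq_bigr do rewrite rmorph_sum /= mulr_suml.
  rewrite (exchange_big_dep predT) //= /terms_val big_seq [RHS]big_seq; apply: eq_bigr => p ps.
  rewrite -big_filter (_ : [seq m <- ms | p.2 == m] = [:: p.2]) ?big_seq1 //.
  have := filter_pred1_uniq (undup_uniq [seq p.2 | p <- s i]) (_ : p.2 \in ms).
  rewrite mem_undup map_f // => /(_ isT) <-; apply: eq_filter => m; exact: eq_sym.
rewrite big_seq big1 // => m; rewrite mem_undup => /mapP[p ps ->].
by rewrite ci ?mul0r // (si p ps) // /= eqxx.
Qed.

End IntegerPolynomials.

(** * The field generated by the parameters and its relative algebraic closure *)

Section AlgebraicClosureIn.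

Variables (K : fieldType) (I : finType) (x : I -> K) (P : pred I).

Definition rat_value : pred K := fun t =>
  `[< exists a b, [/\ int_poly_value x P a, int_poly_value x P b, b != 0 & t = a / b] >].

Fact rat_value_divring_closed : divring_closed rat_value.
Proof.
split=> [|t u|t u].
- apply/asboolP; exists 1, 1; split; rewrite ?divr1 ?oner_neq0 //; exact: int_poly_value1.
- move=> /asboolP[a [b [ha hb b0 ->]]] /asboolP[c [d [hc hd d0 ->]]].
  apply/asboolP; exists (a * d - c * b), (b * d); split.
  + by apply: int_poly_valueB; apply: int_poly_valueM.
  + exact: int_poly_valueM.
  + by rewrite mulf_neq0.
  + by rewrite -mulNr addf_div // mulNr.
- move=> /asboolP[a [b [ha hb b0 ->]]] /asboolP[c [d [hc hd d0 ->]]].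
  (* The inverse of zero is zero, so a quotient by zero is represented as [(1 - 1) / 1]. *)
  have [c0|c0] := eqVneq c 0.
    apply/asboolP; exists (1 - 1), 1; split; rewrite ?oner_neq0 //; try exact: int_poly_value1.
      by apply: int_poly_valueB; exact: int_poly_value1.
    by rewrite c0 mul0r invr0 mulr0 subrr mul0r.
  apply/asboolP; exists (a * d), (b * c); split.
  + exact: int_poly_valueM.
  + exact: int_poly_valueM.
  + by rewrite mulf_neq0.
  + by rewrite invf_div mulf_div.
Qed.

HB.instance Definition _ := GRing.isDivringClosed.Build K rat_value rat_value_divring_closed.

Definition rat_field := {t : K | rat_value t}.

HB.instance Definition _ := SubChoice.on rat_field.
HB.instance Definition _ := [SubChoice_isSubIntegralDomain of rat_field by <:].
HB.instance Definition _ := [SubIntegralDomain_isSubField of rat_field by <:].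

(** Integral over a field means algebraic: this is the relative algebraic closure of [rat_field] in
    [K]. *)
Definition alg_value (t : K) : bool :=
  `[< integralOver (val : rat_field -> K) t >].

Fact alg_value_divring_closed : divring_closed alg_value.
Proof.
split=> [|t u /asboolP ht /asboolP hu|t u /asboolP ht /asboolP hu]; apply/asboolP.
- exact: integral1.
- exact: integral_sub.
- exact: integral_div.
Qed.

HB.instance Definition _ := GRing.isDivringClosed.Build K alg_value alg_value_divring_closed.

Lemma alg_valueX l : P l -> alg_value (x l).
Proof.
move=> Pl.
have Rl : rat_value (x l).
  apply/asboolP; exists (x l), 1; split; rewrite ?divr1 ?oner_neq0 //.
    exact: int_poly_valueX.
  exact: int_poly_value1.
apply/asboolP.
exact: (integral_id (val : {rmorphism rat_field -> K}) (exist (fun t => rat_value t) (x l) Rl)).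
Qed.

Lemma alg_value_root (p : {poly K}) t :
  p != 0 -> p \is a polyOver alg_value -> root p t -> alg_value t.
Proof.
move=> p0 /polyOverP pL pt; apply/asboolP; apply: integral_root p0 pt _.
by move=> _ /(nthP 0)[i _ <-]; have /asboolP := pL i.
Qed.

Lemma rat_value_denominator (s : seq K) : all rat_value s ->
  exists b, [/\ int_poly_value x P b, b != 0 &
    forall t, t \in s -> int_poly_value x P (b * t)].
Proof.
elim: s => [|t s IHs] /=.
  by exists 1; split; rewrite ?oner_neq0 //; exact: int_poly_value1.
move=> /andP[/asboolP[a [b [ha hb b0 ->]]] /IHs[c [hc c0 hs]]].
exists (b * c); split; [exact: int_poly_valueM | by rewrite mulf_neq0|].
move=> u; rewrite inE => /orP[/eqP->|/hs us].
  by rewrite mulrC mulrA divfK // ; apply: int_poly_valueM.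
by rewrite -mulrA; apply: int_poly_valueM.
Qed.

End AlgebraicClosureIn.

(** [L] is the relative algebraic closure of the field generated by the parameters other than [x k].
    If it contained [x k], clearing denominators in a monic equation would contradict
    [indep_int_poly_eq0]. *)
Lemma indep_alg_closed_subfield (K : fieldType) (I : finType) (P : pred I)
    (x : I -> K) k :
  P k -> alg_indep_in P x ->
  exists L : divringClosed K,
  [/\ forall l, P l -> l != k -> x l \in L, x k \notin L &
      forall (p : {poly K}) t, p != 0 -> p \is a polyOver L -> root p t -> t \in L].
Proof.
move=> Pk ind; exists (GRing.DivringClosed.clone _ (alg_value x (predD1 P k)) _); split.
- by move=> l Pl lk; apply: alg_valueX; rewrite /= lk.
- apply/negP => /asboolP [p mp pr].
  pose q := map_poly (val : rat_field x (predD1 P k) -> K) p.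
  have [|b [hb b0 hs]] := @rat_value_denominator _ _ x (predD1 P k) q.
    by apply/allP => _ /(nthP 0)[i _ <-]; rewrite coef_map; exact: valP.
  have q0 : q != 0 by rewrite map_poly_eq0 monic_neq0.
  have sum0 : \sum_(i < size q) b * q`_i * x k ^+ i = 0.
    have := pr; rewrite /root horner_coef => /eqP pr0.
    under eq_bigr do rewrite -mulrA.
    by rewrite -mulr_sumr pr0 mulr0.
  have bq i : (i < size q)%N -> int_poly_value x (predD1 P k) (b * q`_i).
    by move=> iq; apply: hs; apply: mem_nth.
  have := indep_int_poly_eq0 Pk ind bq sum0.
  move=> /(_ (size q).-1); rewrite ltn_predL size_poly_gt0 q0 => /(_ isT)/eqP.
  by rewrite mulf_eq0 (negbTE b0) -lead_coefE lead_coef_eq0 (negbTE q0).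
- exact: alg_value_root.
Qed.

(** * Existence of generic real parameters *)

Section Uncountable.

Import classical_sets functions cardinality.

(** [R_uncountable] excludes bijections, so a surjection is first turned into one by comparing
    cardinals. *)
Lemma nat_not_onto_real (f : nat -> Rdefinitions.R) : exists t, forall m, f m <> t.
Proof.
apply: contrapT => /forallNP onto.
have /choice [g gK] : forall t, exists m, f m = t.
  by move=> t; apply: contrapT => /forallNP ft; apply: (onto t) => m; apply: ft.
have R_nat : ([set: Rdefinitions.R] #= [set: nat])%card.
  apply: eq_card_nat; first by apply/countable_injP; exists g => s t _ _ /(can_inj gK).
  pose nR (m : nat) : Rdefinitions.R := m%:R.
  have inj : {in [set: nat]%classic &, injective nR}.
    by move=> m k _ _ /eqP; rewrite eqr_nat => /eqP.
  by apply/infiniteP; rewrite -(card_le_eql (inj_card_eq inj)); apply: subset_card_le.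
have /card_set_bijP[h] := R_nat.
rewrite setTT_bijective => -[u hu uh].
by apply: (Runcountable.R_uncountable u); exists h.
Qed.

End Uncountable.

Definition setf (I : finType) (T : Type) (x : I -> T) k t : I -> T :=
  fun l => if l == k then t else x l.

Section IndependentReals.

Variable I : finType.

Definition poly_in (x : I -> Rdefinitions.R) (k : I) d (c : {ffun I -> 'I_d} -> int) :
    {poly Rdefinitions.R} :=
  \sum_(e : {ffun I -> 'I_d}) ((c e)%:~R * \prod_(l | l != k) x l ^+ e l) *: 'X^(e k).

Lemma poly_in_horner x k d (c : {ffun I -> 'I_d} -> int) t :
  (poly_in x k c).[t] =
  \sum_(e : {ffun I -> 'I_d}) (c e)%:~R * \prod_l setf x k t l ^+ e l.
Proof.
rewrite /poly_in horner_sum; apply: eq_bigr => e _.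
rewrite hornerZ hornerXn -mulrA; congr (_ * _); rewrite [RHS](bigD1 k) //= /setf eqxx mulrC.
by congr (_ * _); apply: eq_bigr => l /negbTE->.
Qed.

(** Take [e0] with nonzero coefficient. The coefficient of degree [e0 k] is the value of a nonzero
    integer polynomial in the parameters of [P], hence nonzero by independence. *)
Lemma poly_in_neq0 (P : pred I) x k d (c : {ffun I -> 'I_d} -> int) :
  alg_indep_on P x -> ~~ P k ->
  (forall e, c e != 0 -> forall l, ~~ predU1 k P l -> nat_of_ord (e l) = 0%N) ->
  (exists e, c e != 0) -> poly_in x k c != 0.
Proof.
move=> ind Pk cP [e0 ce0]; case: d c cP e0 ce0 => [|d] c cP e0 ce0; first by case: (e0 k).
pose put (m : 'I_d.+1) (e : {ffun I -> 'I_d.+1}) : {ffun I -> 'I_d.+1} :=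
  [ffun l => if l == k then m else e l].
have putK m m' e : put m (put m' e) = put m e.
  by apply/ffunP => l; rewrite !ffunE; case: eqP.
have putid (e : {ffun I -> 'I_d.+1}) : put (e k) e = e.
  by apply/ffunP => l; rewrite !ffunE; case: eqP => // ->.
pose m := e0 k.
(* The slice of [c] at exponent [m] of the variable [k], indexed by vectors with exponent zero at
   [k]. *)
pose c' (e : {ffun I -> 'I_d.+1}) := if e k == 0 then c (put m e) else 0.
suff: (poly_in x k c)`_m != 0 by apply: contraNneq => ->; rewrite coef0.
suff -> : (poly_in x k c)`_m = \sum_e (c' e)%:~R * \prod_l x l ^+ e l.
  apply: ind => [e|]; last first.
    by exists (put 0 e0); rewrite /c' putK putid ffunE !eqxx.
  rewrite /c'; case: ifP => [/eqP ek ce l Pl|]; last by rewrite eqxx.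
  have [->|lk] := eqVneq l k; first by rewrite ek.
  have := cP _ ce l; rewrite ffunE (negbTE lk); apply.
  by rewrite /= (negbTE lk) Pl.
rewrite /poly_in coef_sum [RHS](bigID (fun e : {ffun I -> 'I_d.+1} => e k == 0)) /=.
rewrite [X in _ = _ + X]big1 ?addr0 => [|e ek]; last by rewrite /c' (negbTE ek) mul0r.
rewrite (bigID (fun e : {ffun I -> 'I_d.+1} => e k == m)) /=.
rewrite [X in _ + X = _]big1 ?addr0 => [|e ek]; last first.
  by rewrite coefZ coefXn -val_eqE /= eq_sym in ek *; rewrite (negbTE ek) mulr0.
rewrite (reindex_onto (put m) (put 0)) => [|e /eqP ek] /=; last by rewrite putK -ek putid.
apply: eq_big => [e|e /andP[/eqP mk /eqP ep]].
  rewrite ffunE eqxx eqxx /= putK; apply/eqP/eqP => [<-|<-]; last exact: putid.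
  by rewrite ffunE eqxx.
have ek : e k = 0 by rewrite -ep ffunE eqxx.
rewrite coefZ coefXn mk eqxx mulr1 /c' ek eqxx; congr (_ * _).
rewrite [RHS](bigD1 k) //= ek expr0 mul1r; apply: eq_bigr => l /negbTE lk.
by rewrite ffunE lk.
Qed.

(* Countably many polynomials have to be avoided, each with finitely many roots. *)
Lemma alg_indep_extend (P : pred I) x k : alg_indep_on P x -> ~~ P k ->
  exists t, alg_indep_on (predU1 k P) (setf x k t).
Proof.
move=> ind Pk.
pose D := {d : nat & {ffun {ffun I -> 'I_d} -> int}}.
(* A coefficient function and a position in a list of roots form a countable type, so all roots fit
   in one sequence; numbers that encode nothing give [0]. *)
pose root_of (u : D * nat) := nth 0 (polyrcf.rootsR (poly_in x k (tagged u.1))) u.2.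
have [t tP] := nat_not_onto_real (fun m => oapp root_of 0 (unpickle m)).
exists t => d c cP c0; rewrite -poly_in_horner; apply/negP => pt.
have p0 : poly_in x k (finfun c) != 0.
  apply: (poly_in_neq0 ind Pk); first by move=> e; rewrite ffunE; apply: cP.
  by have [e ce] := c0; exists e; rewrite ffunE.
have {}pt : t \in polyrcf.rootsR (poly_in x k (finfun c)).
  rewrite -polyrcf.roots_on_rootsR // inE /=; apply/rootP; apply/eqP; rewrite -(eqP pt).
  by apply/eqP; congr horner; apply: eq_bigr => e _; rewrite ffunE.
have /(nthP 0)[i _ ti] := pt.
by apply: (tP (pickle (Tagged (fun d => {ffun {ffun I -> 'I_d} -> int}) (finfun c), i)));
  rewrite pickleK.
Qed.

Lemma alg_indep_exists (P : pred I) : exists x, alg_indep_on P x.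
Proof.
suff [x xP] : exists x, alg_indep_on [pred k | k \in enum P] x.
  exists x => d c cP; apply: xP => e ce k; rewrite /= mem_enum; exact: cP.
elim: (enum P) (enum_uniq P) => [_|k s IHs /= /andP[ks /IHs[x xs]]].
  (* Without free parameters a coefficient can be nonzero only at the zero exponent vector. *)
  exists (fun=> 0) => d c cP [e ce].
  rewrite (bigD1 e) //= [X in _ + X]big1 ?addr0 => [|f fe]; last first.
    rewrite (_ : c f = 0) ?mul0r //; apply/eqP; apply: contraNT fe => cf.
    by apply/eqP/ffunP => l; apply: val_inj; rewrite /= cP // cP.
  rewrite mulf_neq0 ?intr_eq0 //; apply/prodf_neq0 => k _.
  by rewrite cP // expr0 oner_neq0.
have [t tP] := alg_indep_extend xs ks; exists (setf x k t) => d c cP.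
by apply: tP => e ce l lk; apply: cP => //; rewrite /= inE.
Qed.

Lemma alg_indep_neq0 (P : pred I) x k : alg_indep_on P x -> P k -> x k != 0.
Proof.
move=> ind Pk.
pose e0 : {ffun I -> 'I_2} := [ffun l => if l == k then ord_max else ord0].
have := ind 2 (fun e => (e == e0)%:R).
rewrite (bigD1 e0) //= [X in _ + X]big1 ?addr0 => [|e /negbTE->]; last by rewrite mul0r.
rewrite eqxx mul1r (bigD1 k) //= big1 ?mulr1 ?ffunE ?eqxx ?expr1 => [|l lk]; last first.
  by rewrite ffunE (negbTE lk) expr0.
apply; last by exists e0; rewrite eqxx.
move=> e; have [-> _ l Pl|] := eqVneq e e0; last by rewrite eqxx.
rewrite ffunE; case: eqP Pl => // ->.
by rewrite Pk.
Qed.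

End IndependentReals.

(** Needed for necessity: [input_configuration] quantifies over all generic realizations and would
    be vacuous without one. *)
Lemma generic_realization_exists n (PF PA : pattern n) (S : {set 'I_n}) :
  exists Fv Av bv, generic_realization PF PA S Fv Av bv.
Proof.
have [x ind] := alg_indep_exists (free_params PF PA S).
(* An independent family is arbitrary outside the free parameters, where a realization must
   vanish. *)
pose y k := if free_params PF PA S k then x k else 0.
have yx k : free_params PF PA S k -> y k = x k by rewrite /y => ->.
exists (\matrix_(i, j) y (inl (inl (i, j)))), (\matrix_(i, j) y (inl (inr (i, j)))),
  (fun i => y (inr i)).
have y0 k : (y k != 0) = free_params PF PA S k.
  by rewrite /y; case: ifP => [|_]; [exact: alg_indep_neq0 | rewrite eqxx].
split=> [i j|i j|i|d c cP c0]; rewrite ?mxE ?y0 //.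
suff -> : \sum_(e : {ffun param_index n -> 'I_d}) (c e)%:~R *
    \prod_k param_family (\matrix_(i, j) y (inl (inl (i, j))))
      (\matrix_(i, j) y (inl (inr (i, j)))) (fun i => y (inr i)) k ^+ e k
  = \sum_(e : {ffun param_index n -> 'I_d}) (c e)%:~R * \prod_k x k ^+ e k by exact: ind.
apply: eq_bigr => e _; have [->|ce] := eqVneq (c e) 0; first by rewrite !mul0r.
congr (_ * _); apply: eq_bigr => k _.
have -> : param_family (\matrix_(i, j) y (inl (inl (i, j))))
      (\matrix_(i, j) y (inl (inr (i, j)))) (fun i => y (inr i)) k = y k.
  by case: k => [[[i j]|[i j]]|i]; rewrite /= ?mxE.
have [/yx->//|/(cP e ce) ->] := boolP (free_params PF PA S k).
by rewrite !expr0.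
Qed.

(** * Determinants of generic pencils *)

Lemma rpred_det (R : comNzRingType) (L : subringClosed R) n (M : 'M[R]_n) :
  (forall i j, M i j \in L) -> \det M \in L.
Proof. by move=> ML; apply: rpred_sum => s _; rewrite rpredMsign rpred_prod. Qed.

(** Expansion along column [j0] gives [M i0 j0] times a nonzero element of [L], plus an element of
    [L]. *)
Lemma det_notin (K : fieldType) (L : divringClosed K) n (M : 'M[K]_n) i0 j0 :
  (forall i j, (i, j) != (i0, j0) -> M i j \in L) -> M i0 j0 \notin L ->
  cofactor M i0 j0 != 0 -> \det M \notin L.
Proof.
move=> ML Mij cof0; have cofL i : cofactor M i j0 \in L.
  rewrite rpredMsign rpred_det // => k l; rewrite !mxE ML //.
  by rewrite xpair_eqE negb_and (eq_sym _ j0) neq_lift orbT.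
rewrite (expand_det_col M j0) (bigD1 i0) //= rpredDr ?rpred_divr //; last first.
  by apply: rpred_sum => i ii0; rewrite rpredM ?ML // xpair_eqE negb_and ii0.
by apply: contra Mij => Mc; rewrite -[M i0 j0](mulfK cof0) rpred_div.
Qed.

Section GenericPencil.

Variables (K : fieldType) (n : nat) (PF PA : pattern n) (F A : 'M[K]_n).

Definition entry (b : bool) i j := if b then F i j else A i j.
Definition pat (b : bool) i j := if b then PF i j else PA i j.

Definition avoids (L : divringClosed K) b i j :=
  [/\ forall b' i' j', (b', i', j') != (b, i, j) -> entry b' i' j' \in L,
      entry b i j \notin L &
      forall (p : {poly K}) t, p != 0 -> p \is a polyOver L -> root p t -> t \in L].

Definition generic_pencil :=
  (forall b i j, ~~ pat b i j -> entry b i j = 0) /\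
  (forall b i j, pat b i j -> exists L, avoids L b i j).

(* The pencil with an individual value [w j] of the indeterminate in each
   column, and with the columns in [T] replaced by unit columns. *)
Definition hybrid (mu : {perm 'I_n}) (T : {set 'I_n}) (w : 'I_n -> K) : 'M[K]_n :=
  \matrix_(i, j) if j \in T then (i == mu j)%:R else A i j - w j * F i j.

(** Expanding along the unit column [j] leaves a single cofactor, which does not involve column
    [j]. *)
Lemma cofactor_hybrid (mu : {perm 'I_n}) (T : {set 'I_n}) w j : j \notin T ->
  cofactor (hybrid mu T w) (mu j) j = \det (hybrid mu (j |: T) w).
Proof.
move=> jT; rewrite (expand_det_col _ j) (bigD1 (mu j)) //= big1 ?addr0.
  rewrite !mxE setU11 eqxx mul1r /cofactor; congr (_ * \det _).
  apply/matrixP => k l; rewrite !mxE in_setU1 -(eq_sym j) (negbTE (neq_lift _ _)) //.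
by move=> i /negbTE imu; rewrite !mxE setU11 imu mul0r.
Qed.

(** The pivot at [(mu j, j)] stays outside [L]: for a parameter of [A] since [w j * F] lies in [L],
    for one of [F] since [w j] is a nonzero element of [L]. *)
Lemma det_hybrid_notin (L : divringClosed K) (mu : {perm 'I_n}) (T : {set 'I_n}) w b j :
  avoids L b (mu j) j -> j \notin T ->
  (forall j', j' \notin T -> w j' \in L) -> (b -> w j != 0) ->
  \det (hybrid mu (j |: T) w) != 0 -> \det (hybrid mu T w) \notin L.
Proof.
move=> [oL eL _] jT wL wb d0.
apply: (@det_notin _ _ _ _ (mu j) j) => [i l il||]; last by rewrite cofactor_hybrid.
  rewrite mxE; case: ifP => [_|/negbT lT]; first exact: rpred_nat.
  have neq c : (c, i, l) != (b, mu j, j) by apply: contra il => /eqP[_ -> ->].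
  by apply: rpredB; [exact: (oL false) | apply: rpredM (wL _ lT) (oL true _ _ _)].
rewrite mxE (negbTE jT); case: b oL eL wb => oL eL wb.
  rewrite rpredBl ?(oL false) //; apply: contra eL => wF.
  by rewrite /entry -(mulKf (wb isT) (F _ _)) rpredM ?rpredV ?wL.
by rewrite rpredBr // rpredM ?wL // (oL true).
Qed.

Hypothesis gen : generic_pencil.

(** The unit columns of [T'] outside [T] are turned back into pencil columns one at a time. Each
    time the determinant stays outside a field, and [0] lies in that field. *)
Lemma det_hybrid_neq0 (mu : {perm 'I_n}) (T T' : {set 'I_n}) w :
  T \subset T' -> \det (hybrid mu T' w) != 0 ->
  (forall j, j \in T' -> j \notin T -> exists b,
     [/\ pat b (mu j) j, b -> w j != 0 &
         forall L, avoids L b (mu j) j -> forall j', j' \notin T -> w j' \in L]) ->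
  \det (hybrid mu T w) != 0.
Proof.
move=> + d0; elim: {T}_.+1 {-2}T (ltnSn #|T' :\: T|) => // m IHm T lem TT' act.
have [/eqP T'T|/set0Pn[j]] := eqVneq (T' :\: T) set0.
  suff -> : T = T' by [].
  by apply/eqP; rewrite eqEsubset TT' -setD_eq0 T'T.
rewrite in_setD => /andP[jT jT']; have [b [pj wj wL]] := act j jT' jT.
have [L Lj] := gen.2 _ _ _ pj.
have /(det_hybrid_notin Lj jT (wL L Lj) wj) : \det (hybrid mu (j |: T) w) != 0.
  apply: IHm.
  - rewrite -ltnS; apply: leq_trans lem; rewrite ltnS; apply: proper_card.
    rewrite properEneq setDS ?subsetUr // andbT.
    by apply/eqP => /setP/(_ j); rewrite !inE eqxx jT jT'.
  - by rewrite subUset sub1set jT'.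
  - move=> l lT'; rewrite in_setU1 negb_or => /andP[lj lT].
    have [c [pl wl wcL]] := act l lT' lT; exists c; split=> // L' /wcL H l'.
    by rewrite in_setU1 negb_or => /andP[_]; apply: H.
by apply: contra => /eqP->; rewrite rpred0.
Qed.

Lemma det_hybridT (mu : {perm 'I_n}) w : \det (hybrid mu setT w) != 0.
Proof.
have -> : hybrid mu setT w = perm_mx (mu^-1)%g.
  by apply/matrixP => i j; rewrite !mxE in_setT (can2_eq (permKV mu) (permK mu)).
by rewrite det_perm signr_eq0.
Qed.

Lemma det_hybrid0_neq0 (mu : {perm 'I_n}) (T : {set 'I_n}) :
  (forall j, j \notin T -> PA (mu j) j) -> \det (hybrid mu T (fun=> 0)) != 0.
Proof.
move=> act; apply: (det_hybrid_neq0 (subsetT T) (det_hybridT _ _)) => j _ /act pj.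
by exists false; split=> // L _ j' _; apply: rpred0.
Qed.

(** The value [1] is nonzero and lies in every subfield, so a pivot may come from [F] or [A]; at [0]
    only pivots from [A] survive. *)
Lemma det_hybrid1_neq0 (mu : {perm 'I_n}) (T : {set 'I_n}) :
  (forall j, j \notin T -> pencil_graph PF PA (mu j) j) ->
  \det (hybrid mu T (fun=> 1)) != 0.
Proof.
move=> act; apply: (det_hybrid_neq0 (subsetT T) (det_hybridT _ _)) => j _ /act.
rewrite /pencil_graph orbC; have [pj _|_ /= pj] := boolP (PF _ _).
  by exists true; split=> // [_|L _ j' _]; [exact: oner_neq0 | apply: rpred1].
by exists false; split=> // L _ j' _; apply: rpred1.
Qed.

End GenericPencil.

(** Independence is first carried to the complex numbers, since the avoiding subfields must be
    algebraically closed in the field where [z] varies. *)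
Lemma generic_realization_pencil n (PF PA : pattern n) S Fv Av bv :
  generic_realization PF PA S Fv Av bv ->
  generic_pencil PF PA (cplx_mx Fv) (cplx_mx Av).
Proof.
move=> [F0 A0 b0 ind].
split=> [[] i j /negP pij|b i j pij].
- rewrite /= mxE; have [->|] := eqVneq (Fv i j) 0; first by rewrite rmorph0.
  by rewrite F0 => /pij.
- rewrite /= mxE; have [->|] := eqVneq (Av i j) 0; first by rewrite rmorph0.
  by rewrite A0 => /pij.
pose x k : Rdefinitions.R[i] := ((param_family Fv Av bv k)%:C)%C.
have indC : alg_indep_in (free_params PF PA S) x.
  move=> d c cP c0; have := ind d c cP c0.
  rewrite -(fmorph_eq0 (real_complex Rdefinitions.R)) rmorph_sum /=.
  congr (_ != 0); apply: eq_bigr => e _; rewrite rmorphM rmorph_int rmorph_prod.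
  by congr (_ * _); apply: eq_bigr => k _; rewrite rmorphXn.
pose idx (b : bool) i j : param_index n := inl (if b then inl (i, j) else inr (i, j)).
have idxP b' i' j' : free_params PF PA S (idx b' i' j') = pat PF PA b' i' j' by case: b'.
have xE b' i' j' : entry (cplx_mx Fv) (cplx_mx Av) b' i' j' = x (idx b' i' j').
  by case: b'; rewrite /= mxE.
have pk : free_params PF PA S (idx b i j) by rewrite idxP.
have [L [oL eL cL]] := indep_alg_closed_subfield pk indC.
exists L; split=> //; last by rewrite xE.
move=> b' i' j' neq; rewrite xE.
have [pk'|npk'] := boolP (pat PF PA b' i' j').
  apply: oL; rewrite ?idxP //; apply: contra neq => /eqP.
  by rewrite /idx; case: (b'); case: (b) => // -[-> ->].
suff -> : x (idx b' i' j') = 0 by apply: rpred0.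
apply/eqP; rewrite fmorph_eq0.
by case: b' npk' {neq}; rewrite /= -?F0 -?A0 negbK.
Qed.

(** * Matchings and permutations *)

Section Matchings.

Variables (n : nat) (E : pattern n).

Lemma matching_edge (M : {set 'I_n * 'I_n}) p : is_matching E M -> p \in M -> E p.1 p.2.
Proof. by move=> /andP[/forall_inP ME _] /ME. Qed.

Lemma matching_inj (M : {set 'I_n * 'I_n}) p q : is_matching E M ->
  p \in M -> q \in M -> (p.1 == q.1) || (p.2 == q.2) -> p = q.
Proof. by move=> /andP[_ /forall_inP MI] /MI/forall_inP pM /pM/implyP pq /pq/eqP. Qed.

Lemma sub_matching (M M' : {set 'I_n * 'I_n}) :
  is_matching E M -> M' \subset M -> is_matching E M'.
Proof.
move=> mM /subsetP sub; apply/andP; split; apply/forall_inP => p /sub pM.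
  exact: matching_edge pM.
by apply/forall_inP => q /sub qM; apply/implyP => /(matching_inj mM pM qM) ->.
Qed.

(** Induction on [#|M|]: a permutation for [M] without [(i, j)] is corrected by a transposition that
    fixes the other covered rows. Off [M] it need not follow edges. *)
Lemma matching_perm (M : {set 'I_n * 'I_n}) : is_matching E M ->
  exists mu : {perm 'I_n}, forall p, p \in M -> mu p.2 = p.1.
Proof.
elim: {M}_.+1 {-2}M (ltnSn #|M|) => // m IHm M leM mM.
have [->|[[i j] ijM]] := set_0Vmem M; first by exists 1%g => p; rewrite inE.
have [||mu muP] := IHm (M :\ (i, j)).
- by rewrite (cardsD1 (i, j)) ijM in leM.
- by apply: sub_matching mM _; apply: subsetDl.
exists (mu * tperm (mu j) i)%g => p pM; rewrite permM.
have [->|pij] := eqVneq p (i, j); first by rewrite tpermL.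
have pD : p \in M :\ (i, j) by rewrite !inE pij.
rewrite muP //.
rewrite tpermD //; apply: contraNneq pij => h; apply/eqP/(matching_inj mM pM ijM) => /=.
  by move: h; rewrite -muP // => /perm_inj ->; rewrite eqxx orbT.
by rewrite -h eqxx.
Qed.

Lemma card_covered_cols (M : {set 'I_n * 'I_n}) : is_matching E M -> #|covered_cols M| = #|M|.
Proof.
move=> mM; apply: card_in_imset => p q pM qM pq.
by apply: (matching_inj mM) => //; rewrite pq eqxx orbT.
Qed.

Lemma perfect_matching_perm (M : {set 'I_n * 'I_n}) : nu E = n -> is_max_matching E M ->
  exists2 mu : {perm 'I_n}, (forall j, E (mu j) j) &
    forall i j, ((i, j) \in M) = (i == mu j).
Proof.
move=> nun [mM maxM]; have [mu muP] := matching_perm mM.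
have cM : covered_cols M = setT.
  apply/eqP; rewrite eqEcard subsetT cardsT card_ord card_covered_cols //=.
  by rewrite -{1}nun; apply/bigmax_leqP => M' /maxM.
have inM j : (mu j, j) \in M.
  have : j \in covered_cols M by rewrite cM inE.
  by case/imsetP => -[i j'] pM /= ->; have /= := muP _ pM => ->.
exists mu => [j|i j]; first exact: (matching_edge mM (inM j)).
by apply/idP/eqP => [/muP //|->].
Qed.

End Matchings.

(** * Reachability between rows and rotation of a perfect matching *)

Section Reachability.

Variables (n : nat) (E : pattern n) (mu : {perm 'I_n}).

(** One step takes the matching arc from [e_a] to its variable, then any edge to [e_b]. *)
Definition reach : rel 'I_n := fun a b => E b ((mu^-1)%g a).

Lemma reach_edge i j : E i j -> connect reach (mu j) i.
Proof. by move=> Eij; apply: connect1; rewrite /reach permK. Qed.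

Hypothesis Emu : forall j, E (mu j) j.

(** The column of each row on the walk takes the next row, along an edge; the column of the last row
    takes [a], which need not be an edge. *)
Lemma rotate_path a p : path reach a p -> uniq (a :: p) ->
  exists mu' : {perm 'I_n},
  [/\ mu' ((mu^-1)%g (last a p)) = a,
      forall j, mu j != last a p -> E (mu' j) j,
      forall j, mu j \notin a :: p -> mu' j = mu j &
      forall j, mu' j != mu j -> connect reach (mu j) (last a p)].
Proof.
elim: p a => [|c p IHp] a /=.
  by exists mu; split=> //; [rewrite permKV | move=> j; rewrite eqxx].
move=> /andP[ac cp] /andP[acp /(IHp c cp) [mu1 [m1b m1E m1off m1c]]].
have m1a : mu1 ((mu^-1)%g a) = a by rewrite m1off permKV.
have ab : a != last c p by apply: contraNneq acp => ->; exact: mem_last.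
have a_c : a != c by apply: contraNneq acp => ->; exact: mem_head.
have con : connect reach a (last c p).
  by apply/connectP; exists (c :: p) => //=; rewrite ac.
(* [mu1] gives the last column the row [c] and leaves [a] to its own column; the transposition
   exchanges these two values. *)
exists (mu1 * tperm a c)%g; split=> [|j jb|j|j].
- by rewrite permM m1b tpermR.
- rewrite permM; have [ja|ja] := eqVneq (mu j) a.
    have -> : j = (mu^-1)%g a by rewrite -ja permK.
    by rewrite m1a tpermL.
  rewrite tpermD ?m1E //.
    apply: contraNneq ja => h; have /perm_inj <- : mu1 ((mu^-1)%g a) = mu1 j by rewrite m1a.
    by rewrite permKV.
  apply: contraNneq jb => h; have /perm_inj <- : mu1 ((mu^-1)%g (last c p)) = mu1 j.
    by rewrite m1b.
  by rewrite permKV.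
- rewrite inE negb_or => /andP[ja jcp]; rewrite permM m1off //.
  by rewrite tpermD // eq_sym //; apply: contraNneq jcp => ->; exact: mem_head.
- rewrite permM; have [->//|ja] := eqVneq (mu j) a.
  have [m1j|/m1c//] := eqVneq (mu1 j) (mu j).
  have [m1jc|m1jc] := eqVneq (mu1 j) c.
    by rewrite -m1j m1jc => _; apply/connectP; exists p.
  by rewrite tpermD ?m1j ?eqxx // eq_sym // -m1j.
Qed.

Lemma rotate a j0 : connect reach a (mu j0) ->
  exists mu' : {perm 'I_n},
  [/\ mu' j0 = a, forall j, j != j0 -> E (mu' j) j &
      forall j, mu' j != mu j -> connect reach (mu j) (mu j0)].
Proof.
move=> /connectP[q pq bq]; case/shortenP: pq bq => p pp up _ bq.
have [mu' [mb mE _ mc]] := rotate_path pp up; rewrite -bq in mb mE mc.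
exists mu'; split=> //; first by rewrite -mb permK.
by move=> j jj0; apply: mE; rewrite (inj_eq perm_inj).
Qed.

End Reachability.

(** * The DM order in terms of reachability between rows *)

Section DMOrder.

Variables (n : nat) (PF PA : pattern n) (M0 : {set 'I_n * 'I_n}) (mu : {perm 'I_n}).
Let E := pencil_graph PF PA.
Hypotheses (Emu : forall j, E (mu j) j) (M0mu : forall i j, ((i, j) \in M0) = (i == mu j)).

Definition row_of (u : node n) : 'I_n := match u with inl j => mu j | inr i => i end.

(** A matching edge carries arcs both ways, so every node is equivalent to its row. *)
Lemma connect_aux u v : connect (aux_arc E M0) u v = connect (reach E mu) (row_of u) (row_of v).
Proof.
have to_row w : connect (aux_arc E M0) w (inr (row_of w)).
  by case: w => [j|i] /=; [apply: connect1; exact: Emu | exact: connect0].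
have of_row w : connect (aux_arc E M0) (inr (row_of w)) w.
  by case: w => [j|i] /=; [apply: connect1; rewrite /= M0mu | exact: connect0].
apply/idP/idP => [/connectP[p pp ->]|/connectP[p pp e]].
  elim: p u pp => [|w p IHp] u /=; first by rewrite connect0.
  move=> /andP[uw /IHp]; apply: connect_trans.
  case: u w uw => [j|i] [k|l] //=; first exact: reach_edge.
  by rewrite M0mu => /eqP->.
apply: connect_trans (to_row u) _; apply: connect_trans _ (of_row v); rewrite e.
elim: p (row_of u) pp {e} => [|b p IHp] a /=; first by rewrite connect0.
move=> /andP[ab /IHp]; apply: connect_trans.
apply: (@connect_trans _ _ (inl ((mu^-1)%g a))); apply: connect1; rewrite /= ?M0mu ?permKV //.
Qed.

Lemma V0_perfect : V0 E M0 = set0.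
Proof.
apply/setP => v; rewrite !inE; apply/existsP => -[j /andP[/imsetP[]]].
by exists (mu j, j); rewrite // M0mu.
Qed.

Lemma Vinf_perfect : Vinf E M0 = set0.
Proof.
apply/setP => v; rewrite !inE; apply/existsP => -[i /andP[/imsetP[]]].
by exists (i, (mu^-1)%g i); rewrite // M0mu permKV.
Qed.

Lemma mid_perfect v : mid_node E M0 v.
Proof. by rewrite /mid_node V0_perfect Vinf_perfect !inE. Qed.

Lemma sccE u v : (v \in scc E M0 u) =
  connect (reach E mu) (row_of u) (row_of v) && connect (reach E mu) (row_of v) (row_of u).
Proof.
have eqc : connect (mid_arc E M0) =2 connect (aux_arc E M0).
  by apply: eq_connect => a b; rewrite /mid_arc !mid_perfect.
by rewrite inE mid_perfect !eqc !connect_aux.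
Qed.

Lemma dm_compE u : dm_comp E M0 u = scc E M0 u.
Proof. by rewrite /dm_comp V0_perfect Vinf_perfect !inE. Qed.

(* A pair [(i, j)] with [PF i j] and [connect (reach E mu) i (mu j)] is an s-arc
   whose two ends lie in the same component. *)
Lemma maximal_s_comp_cover (C : {set 'I_n}) :
  (forall K, maximal_s_comp PF PA M0 K ->
     exists2 c, c \in C & dm_le E M0 K (dm_comp E M0 (inr c))) <->
  (forall i j, PF i j -> connect (reach E mu) i (mu j) ->
     exists2 c, c \in C & connect (reach E mu) c i).
Proof.
have EF i j : PF i j -> connect (reach E mu) (mu j) i.
  by move=> p; apply: reach_edge; rewrite /E /pencil_graph p orbT.
split=> [cov i j pij cij|cov K [[[u [_ ->]]]]].
  (* Among the s-arcs inside components whose row reaches [i], one whose row reaches the most rows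
     lies in a maximal s-component. *)
  pose ok (q : 'I_n * 'I_n) := [&& PF q.1 q.2, connect (reach E mu) q.1 (mu q.2) &
    connect (reach E mu) q.1 i].
  have ok0 : ok (i, j) by rewrite /ok /= pij cij connect0.
  have [[i' j'] /and3P[/= p' c' ci'] mx] :=
    @arg_maxnP _ (i, j) ok (fun q => #|connect (reach E mu) q.1|) ok0.
  have [|c cC [u [v []]]] := cov (scc E M0 (inr i')).
    split.
      split; first by exists (inr i'); split=> //; exact: mid_perfect.
      apply/existsP; exists i'; apply/existsP; exists j'; rewrite p' !sccE /= connect0 /=.
      by rewrite c' EF.
    move=> K' [[u' [_ ->]] /existsP[i2 /existsP[j2 /and3P[p2]]]] + + neq.
    rewrite !sccE /= => /andP[u2 r2] /andP[u3 r3] [u [v []]].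
    rewrite !sccE connect_aux /= => /andP[uu' u'u] /andP[vi iv] uv.
    have c2 : connect (reach E mu) i2 i'.
      apply: connect_trans (connect_trans r2 uu') _; exact: connect_trans uv iv.
    have c22 : connect (reach E mu) i2 (mu j2) by apply: connect_trans r2 u3.
    have := mx (i2, j2); rewrite /ok /= p2 c22 (connect_trans c2 ci') => /(_ isT) le.
    (* By the choice of [i'] this inclusion is an equality, so [i'] reaches [i2] back and the two
       components coincide. *)
    have sub : connect (reach E mu) i' \subset connect (reach E mu) i2.
      by apply/subsetP => a; rewrite !inE; apply: connect_trans.
    have : i2 \in connect (reach E mu) i'.
      rewrite (subset_cardP _ sub) ?inE ?connect0 //.
      by apply/eqP; rewrite eqn_leq subset_leq_card.
    rewrite inE => i'2; apply: neq; apply/setP => v'; rewrite !sccE /=.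
    have ui' : connect (reach E mu) (row_of u') i' by apply: connect_trans u2 c2.
    have i'u : connect (reach E mu) i' (row_of u') by apply: connect_trans i'2 r2.
    apply/andP/andP => -[h1 h2]; split.
    - exact: connect_trans i'u h1.
    - exact: connect_trans h2 ui'.
    - exact: connect_trans ui' h1.
    - exact: connect_trans h2 i'u.
  rewrite dm_compE !sccE connect_aux /= => /andP[cu _] /andP[_ vi] uv.
  exists c => //; apply: connect_trans ci'.
  by apply: connect_trans cu _; apply: connect_trans uv vi.
move=> /existsP[i /existsP[j /and3P[pij iK jK]]] _.
have := iK; have := jK; rewrite !sccE /= => /andP[uj ju] /andP[ui iu].
have [c cC ci] := cov i j pij (connect_trans iu uj).
exists c => //; exists (inr c), (inr i); split=> //.
  by rewrite dm_compE sccE connect0.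
by rewrite connect_aux.
Qed.

End DMOrder.

(** * Sufficiency: left null vectors vanishing on the inputs *)

Section Pencil.

Variables (K : fieldType) (n : nat) (PF PA : pattern n) (F A : 'M[K]_n).
Hypothesis gen : generic_pencil PF PA F A.
Local Notation E := (pencil_graph PF PA).
Local Notation hyb := (hybrid F A).

Lemma mul_hybrid (y : 'rV[K]_n) (mu : {perm 'I_n}) (T : {set 'I_n}) (w : 'I_n -> K) j :
  (y *m hyb mu T w) 0 j =
  if j \in T then y 0 (mu j) else (y *m A) 0 j - w j * (y *m F) 0 j.
Proof.
rewrite !mxE; case: ifP => jT.
  rewrite (bigD1 (mu j)) //= mxE jT eqxx mulr1 big1 ?addr0 // => i /negbTE imu.
  by rewrite mxE jT imu mulr0.
rewrite mulr_sumr -sumrB; apply: eq_bigr => i _; rewrite mxE jT mulrBr; congr (_ - _).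
by rewrite mulrCA.
Qed.

Definition hybrid_poly (mu : {perm 'I_n}) (T : {set 'I_n}) : {poly K} :=
  \det (\matrix_(i, j) if j \in T then (i == mu j)%:R else (A i j)%:P - 'X * (F i j)%:P).

Lemma hybrid_polyE mu T s : (hybrid_poly mu T).[s] = \det (hyb mu T (fun=> s)).
Proof.
rewrite -horner_evalE -det_map_mx; congr (\det _); apply/matrixP => i j.
rewrite !mxE; case: ifP => _; first by rewrite rmorph_nat.
by rewrite /= horner_evalE !hornerE.
Qed.

Lemma hybrid_poly_over (L : divringClosed K) mu (T : {set 'I_n}) :
  (forall b i j, j \notin T -> entry F A b i j \in L) -> hybrid_poly mu T \is a polyOver L.
Proof.
move=> eL; apply: rpred_det => i j; rewrite mxE; case: ifP => [_|/negbT jT].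
  exact: rpred_nat.
by rewrite rpredB ?rpredM ?polyOverX ?polyOverC ?(eL false) ?(eL true).
Qed.

Lemma entry0 b i j : ~~ E i j -> entry F A b i j = 0.
Proof.
by rewrite /pencil_graph negb_or => /andP[nA nF]; apply: gen.1; case: b.
Qed.

(** The columns of [A] covered by [M], completed by unit columns at uncovered rows, form an
    invertible matrix that [y] annihilates. *)
Lemma null_at0 (M : {set 'I_n * 'I_n}) (S : {set 'I_n}) (y : 'rV[K]_n) :
  is_matching PA M -> ~: covered_rows M \subset S ->
  y *m A = 0 -> (forall c, c \in S -> y 0 c = 0) -> y = 0.
Proof.
move=> mM sub yA yS; have [mu muP] := matching_perm mM.
have /(det_hybrid0_neq0 gen)/det0P d0 : forall j, j \notin ~: covered_cols M -> PA (mu j) j.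
  move=> j; rewrite inE negbK => /imsetP[p pM ->]; rewrite muP //.
  exact: matching_edge mM pM.
apply/eqP/negPn/negP => y0; apply: d0; exists y => //; apply/rowP => j.
rewrite mul_hybrid yA !mxE mul0r subr0; case: ifP => //.
rewrite inE => jM; apply: yS; apply: (subsetP sub); rewrite inE; apply: contra jM.
case/imsetP => p pM; rewrite -muP // => /perm_inj ->; exact: imset_f.
Qed.

Variable mu : {perm 'I_n}.
Hypothesis Emu : forall j, E (mu j) j.
Local Notation reachable := (connect (reach E mu)).

(** Columns of s-arcs inside a component; the s-arc itself gives the reverse walk from [mu j] to
    [i]. *)
Definition s_columns : {set 'I_n} := [set j | [exists i, PF i j && reachable i (mu j)]].

(* The edges of a perfect matching form closed walks, so that only edges inside
   components contribute to the determinant. *)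
Lemma perfect_matching_reach (s : {perm 'I_n}) i :
  (forall k, E k (s k)) -> reachable i (mu (s i)).
Proof.
(* Each application of [t] is one step of [reach], and the orbits of [t] are cycles, so the preimage
   of [i] is reachable from [i]. *)
move=> Es; pose t : {perm 'I_n} := (mu^-1 * s^-1)%g.
have -> : mu (s i) = (t^-1)%g i by rewrite /t invMg !invgK permM.
have : fconnect t i ((t^-1)%g i).
  rewrite fconnect_sym; last exact: perm_inj.
  by apply: connect1; rewrite /= permKV.
apply: connect_sub => a _ /eqP <-; apply: connect1.
by have := Es (t a); rewrite /reach /t permM permKV.
Qed.

(** A nonzero term of the expansion follows a perfect matching, whose s-arcs all end in [s_columns].
    Elsewhere [z] may be replaced by [1], which lies in every subfield. *)
Lemma det_hybrid_s_columns z :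
  \det (A - z *: F) = \det (hyb mu set0 (fun j => if j \in s_columns then z else 1)).
Proof.
apply: eq_bigr => s _; congr (_ * _).
have [/forallP Es|/forallPn[i nE]] := boolP [forall i, E i (s i)].
  apply: eq_bigr => i _; rewrite !mxE in_set0.
  have [pij|npij] := boolP (PF i (s i)).
    suff -> : s i \in s_columns by [].
    by rewrite inE; apply/existsP; exists i; rewrite pij perfect_matching_reach.
  by have /= -> := gen.1 true _ _ npij; rewrite !mulr0.
have [f0 a0] := (entry0 true nE, entry0 false nE); rewrite /= in f0 a0.
by rewrite (bigD1 i) //= [in RHS](bigD1 i) //= !mxE in_set0 a0 f0 !mulr0 subrr !mul0r.
Qed.

Section NullVector.

Variables (S : {set 'I_n}) (z : K) (y : 'rV[K]_n).
Hypothesis cover : forall i j, PF i j -> reachable i (mu j) ->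
  exists2 c, c \in S & reachable c i.
Hypotheses (z0 : z != 0) (yD : y *m (A - z *: F) = 0).
Hypotheses (yS : forall c, c \in S -> y 0 c = 0) (y0 : y != 0).

Lemma null_column j : (y *m A) 0 j - z * (y *m F) 0 j = 0.
Proof. by have /rowP/(_ j) := yD; rewrite mulmxBr -scalemxAr !mxE. Qed.

(* Moving the matching along a walk from an input to column [j] gives a polynomial
   equation for [z] in which the entries of column [j] do not occur. *)
Lemma null_value_in (L : divringClosed K) j : j \in s_columns ->
  (forall b i k, k != j -> entry F A b i k \in L) ->
  (forall (p : {poly K}) t, p != 0 -> p \is a polyOver L -> root p t -> t \in L) ->
  z \in L.
Proof.
rewrite inE => /existsP[i /andP[pij rij]] eL closed.
have [c cS ci] := cover pij rij.
have [mu' [mj mE _]] := rotate Emu (connect_trans ci rij).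
(* With column [j] replaced by the unit column of the input row [c], [y] still annihilates the
   matrix at [z], while [mu'] makes the determinant nonzero at [1]. *)
apply: (closed (hybrid_poly mu' [set j])).
- have : (hybrid_poly mu' [set j]).[1] != 0.
    rewrite hybrid_polyE; apply: (det_hybrid1_neq0 gen) => k; rewrite inE; exact: mE.
  by apply: contraNneq => ->; rewrite horner0.
- by apply: hybrid_poly_over => b l k; rewrite inE; apply: eL.
- rewrite /root hybrid_polyE; apply/det0P; exists y => //; apply/rowP => k.
  rewrite mul_hybrid null_column mxE inE; case: eqP => // ->.
  by rewrite mj yS.
Qed.

Lemma null_vector_absurd : False.
Proof.
suff : \det (A - z *: F) != 0 by move/det0P; apply; exists y.
rewrite det_hybrid_s_columns.
have act j : exists b, pat PF PA b (mu j) j.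
  by have := Emu j; rewrite /pencil_graph => /orP[]; [exists false | exists true].
(* Columns outside [s_columns] are restored first, when only the value [1] has to lie in [L]. For
   the remaining ones [null_value_in] puts [z] in [L]. *)
apply: (det_hybrid_neq0 gen (sub0set s_columns)).
  apply: (det_hybrid_neq0 gen (subsetT _) (det_hybridT _ _ _ _)) => j _ jF.
  have [b pb] := act j; exists b; split=> // [_|L _ k kF].
    by rewrite (negbTE jF) oner_neq0.
  by rewrite (negbTE kF) rpred1.
move=> j jF _; have [b pb] := act j; exists b; split=> // [_|L [oL _ cL] k _].
  by rewrite jF.
case: ifP => _; last exact: rpred1.
apply: (null_value_in jF _ cL) => b' i l lj; apply: oL.
by apply: contra lj => /eqP[_ _ ->].
Qed.

End NullVector.

Lemma null_vector_eq0 (M : {set 'I_n * 'I_n}) (S : {set 'I_n}) z (y : 'rV[K]_n) :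
  is_matching PA M -> ~: covered_rows M \subset S ->
  (forall i j, PF i j -> reachable i (mu j) -> exists2 c, c \in S & reachable c i) ->
  y *m (A - z *: F) = 0 -> (forall c, c \in S -> y 0 c = 0) -> y = 0.
Proof.
move=> mM sub cover yD yS; have [z0|z0] := eqVneq z 0.
  by apply: (null_at0 mM sub _ yS); rewrite z0 scale0r subr0 in yD.
by apply/eqP/negPn/negP => y0; apply: (null_vector_absurd cover z0 yD yS y0).
Qed.

End Pencil.

(** * Necessity: a matching from a row basis, and an unreached s-arc *)

Lemma rowsub_free (K : fieldType) m m' n (f : 'I_m' -> 'I_m) (M : 'M[K]_(m, n)) :
  injective f ->
  (forall y : 'rV_m, (forall c, c \notin codom f -> y 0 c = 0) -> y *m M = 0 -> y = 0) ->
  row_free (rowsub f M).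
Proof.
move=> f_inj null; apply: inj_row_free => v; rewrite rowsubE mulmxA => vM.
(* Padding [v] with zeros outside the image of [f] turns a relation between the selected rows into a
   left null vector of [M]. *)
have vE c : (v *m rowsub f 1%:M) 0 c = \sum_k v 0 k * (f k == c)%:R.
  by rewrite mxE; apply: eq_bigr => k _; rewrite !mxE.
have v0 : v *m rowsub f 1%:M = 0.
  apply: null vM => c fc; rewrite vE big1 // => k _.
  by case: eqP fc => [<-|_ _]; rewrite ?codom_f ?mulr0.
apply/rowP => k; have /rowP/(_ (f k)) := v0; rewrite vE (bigD1 k) //= eqxx mulr1.
rewrite big1 ?addr0 => [->|l lk]; first by rewrite !mxE.
by rewrite (inj_eq f_inj) (negbTE lk) mulr0.
Qed.

Section Necessity.

Variables (K : closedFieldType) (n : nat) (PF PA : pattern n) (F A : 'M[K]_n).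
Hypothesis gen : generic_pencil PF PA F A.
Variable S : {set 'I_n}.
Local Notation E := (pencil_graph PF PA).
Local Notation hyb := (hybrid F A).

(** The covered columns of [A] are part of an invertible hybrid matrix, hence independent. *)
Lemma matching_le_rank (M : {set 'I_n * 'I_n}) : is_matching PA M -> (#|M| <= \rank A)%N.
Proof.
move=> mM; have [mu muP] := matching_perm mM.
pose H := hyb mu (~: covered_cols M) (fun=> 0).
have H0 : \det H != 0.
  apply: (det_hybrid0_neq0 gen) => j; rewrite inE negbK => /imsetP[p pM ->].
  by rewrite muP //; exact: matching_edge mM pM.
pose f : 'I_#|covered_cols M| -> 'I_n := enum_val.
have /eqP rk : row_free (rowsub f H^T).
  apply: rowsub_free => [|y _]; first exact: enum_val_inj.
  by move/eqP; rewrite mulmx_free_eq0 ?row_free_unit ?unitmx_tr ?unitmxE ?unitfE // => /eqP.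
rewrite -(card_covered_cols mM) -rk.
have -> : rowsub f H^T = rowsub f A^T.
  apply/matrixP => k i; rewrite !mxE inE.
  by rewrite (enum_valP k : f k \in covered_cols M) mul0r subr0.
by rewrite -(mxrank_tr A); apply: mxrankS; apply: rowsub_sub.
Qed.

Lemma max_matching_cover :
  (forall y : 'rV[K]_n, y *m A = 0 -> (forall c, c \in S -> y 0 c = 0) -> y = 0) ->
  exists2 M, is_max_matching PA M & ~: covered_rows M \subset S.
Proof.
move=> null.
pose ok (R : {set 'I_n}) := (~: S \subset R) && `[< forall y : 'rV[K]_n,
  (forall c, c \notin R -> y 0 c = 0) -> y *m A = 0 -> y = 0 >].
have ok0 : ok (~: S).
  rewrite /ok subxx; apply/asboolP => y yR yA; apply: null => // c cS.
  by apply: yR; rewrite inE cS.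
have [R /andP[SR /asboolP nullR] mx] := @arg_maxnP _ (~: S) ok (fun R => #|R|) ok0.
pose f : 'I_#|R| -> 'I_n := enum_val.
have f_inj : injective f by exact: enum_val_inj.
have fR k : f k \in R by exact: enum_valP.
have f_codom c : c \notin codom f -> c \notin R.
  by apply: contra => cR; apply/codomP; exists (enum_rank_in cR c); rewrite /f enum_rankK_in.
have free : row_free (rowsub f A).
  apply: rowsub_free => // y yc; apply: nullR => c cR; apply: yc.
  by apply: contra cR => /codomP[k ->].
have rowR i : i \in R -> (row i A <= rowsub f A)%MS.
  move=> iR; have -> : row i A = row (enum_rank_in iR i) (rowsub f A).
    by rewrite row_rowsub /f enum_rankK_in.
  exact: row_sub.
(* [R] is a largest independent set of rows containing the complement of [S], so every other row
   depends on it. *)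
have rankA : (\rank A <= #|R|)%N.
  rewrite -(eqP free); apply: mxrankS; apply/row_subP => i.
  have [/rowR//|iR] := boolP (i \in R).
  apply: contrapT => ispan.
  suff : (#|i |: R| <= #|R|)%N by rewrite cardsU1 iR ltnn.
  apply: mx; rewrite /ok (subset_trans SR (subsetUr _ _)) /=; apply/asboolP => y yc yA.
  have [yi|yi] := eqVneq (y 0 i) 0.
    apply: nullR yA => c cR; have [->//|ci] := eqVneq c i.
    by apply: yc; rewrite !inE negb_or ci.
  case: ispan; rewrite -(eqmx_scale _ yi).
  have -> : y 0 i *: row i A = - \sum_(k | k != i) y 0 k *: row k A.
    apply/eqP; rewrite -addr_eq0; apply/eqP.
    by rewrite -[RHS]yA mulmx_sum_row [RHS](bigD1 i).
  rewrite eqmx_opp; apply: summx_sub => k ki.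
  have [kR|kR] := boolP (k \in R); first by apply: scalemx_sub; exact: rowR.
  by rewrite yc ?scale0r ?sub0mx // !inE negb_or ki.
have full : row_full (rowsub f A)^T by rewrite /row_full mxrank_tr.
pose g := fullrankfun full.
have g_inj : injective g by exact: fullrankfun_inj.
have detg : \det (rowsub g (rowsub f A)^T) != 0.
  by rewrite -unitfE -unitmxE; exact: fullrowsub_unit.
(* A nonzero minor has a nonzero term, whose factors are edges of the graph of [A]. *)
have [s sP] : exists s : 'S_#|R|, forall k, PA (f (s k)) (g k).
  apply: contrapT => /forallNP no; move/eqP: detg; apply; apply: big1 => s _.
  have /existsNP[k /negP nk] := no s.
  rewrite (bigD1 k) //= !mxE.
  by have /= -> := gen.1 false _ _ nk; rewrite mul0r mulr0.
pose M := [set (f (s k), g k) | k : 'I_#|R|].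
have cardM : #|M| = #|R|.
  by rewrite card_imset ?card_ord // => k l [_ /g_inj].
exists M.
  split=> [|M' mM']; last by rewrite cardM; apply: leq_trans (matching_le_rank mM') rankA.
  apply/andP; split; apply/forall_inP => _ /imsetP[k _ ->]; first exact: sP.
  apply/forall_inP => _ /imsetP[l _ ->]; apply/implyP => /=.
  by case/orP => /eqP => [/f_inj/perm_inj|/g_inj] ->.
rewrite subCset; apply: subset_trans SR _; apply/subsetP => c cR.
apply/imsetP; exists (c, g ((s^-1)%g (enum_rank_in cR c))) => //.
by apply/imsetP; exists ((s^-1)%g (enum_rank_in cR c)); rewrite // permKV /f enum_rankK_in.
Qed.

Variable mu : {perm 'I_n}.
Hypothesis Emu : forall j, E (mu j) j.
Local Notation reachable := (connect (reach E mu)).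

(* If no input reaches the s-arc, the block of rows that reach it has a nonconstant
   determinant, hence a finite eigenvalue that the inputs cannot see. *)
Lemma s_arc_reached i0 j0 :
  (forall z (y : 'rV[K]_n), y *m (A - z *: F) = 0 ->
     (forall c, c \in S -> y 0 c = 0) -> y = 0) ->
  PF i0 j0 -> reachable i0 (mu j0) -> exists2 c, c \in S & reachable c i0.
Proof.
move=> null p0 r0; apply: contrapT => no.
pose U := [set c | reachable c i0].
pose T := [set j | mu j \notin U].
(* The rotation makes the s-arc the pivot of column [j0]. It moves only columns matched within [U],
   so the unit columns of [T] stay those of [mu]. *)
have [mu' [mj mE mc]] := rotate Emu r0.
have j0i0 : reachable (mu j0) i0 by apply: reach_edge; rewrite /pencil_graph p0 orbT.
have mT j : j \in T -> mu' j = mu j.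
  rewrite !inE; apply: contraNeq => /mc jj0; exact: connect_trans jj0 j0i0.
have j0T : j0 \notin T by rewrite !inE j0i0.
have [L Lav] := gen.2 true _ _ p0; rewrite -mj in Lav.
(* A value outside [L] at [1] and one inside [L] at [0] show that the polynomial is not constant. *)
have q1 : (hybrid_poly F A mu' T).[1] \notin L.
  rewrite hybrid_polyE; apply: (det_hybrid_notin Lav j0T) => [j _|_|].
  - exact: rpred1.
  - exact: oner_neq0.
  - apply: (det_hybrid1_neq0 gen) => j; rewrite in_setU1 negb_or => /andP[jj0 _].
    exact: mE.
have q0 : (hybrid_poly F A mu' T).[0] \in L.
  rewrite hybrid_polyE; apply: rpred_det => i j; rewrite mxE; case: ifP => _.
    exact: rpred_nat.
  by rewrite mul0r subr0; case: Lav => oL _ _; apply: (oL false).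
have /closed_rootP[z] : size (hybrid_poly F A mu' T) != 1.
  apply: contraNneq q1 => /eqP/size_poly1P[c _ qc].
  by move: q0; rewrite qc !hornerC.
rewrite /root hybrid_polyE => /det0P[y y0 yH].
have yU c : c \notin U -> y 0 c = 0.
  move=> cU; have cT : (mu^-1)%g c \in T by rewrite inE permKV.
  have /rowP/(_ ((mu^-1)%g c)) := yH.
  by rewrite mul_hybrid cT mT // permKV mxE.
move/eqP: y0; apply; apply: (null z) => [|c cS]; last first.
  by apply: yU; rewrite inE; apply/negP => ci; apply: no; exists c.
apply/rowP => j; have [jT|jT] := boolP (j \in T); last first.
  have /rowP/(_ j) := yH; rewrite mul_hybrid (negbTE jT) => yj.
  by rewrite mulmxBr -scalemxAr -[RHS]yj !mxE.
rewrite !mxE big1 // => i _; have [iU|/yU->] := boolP (i \in U); last by rewrite mul0r.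
(* An edge from a row of [U] to column [j] would let [mu j] reach [i0], against [j] in [T]. *)
have nE : ~~ E i j.
  move: jT; rewrite !inE; apply: contra => /(reach_edge mu) ji; apply: connect_trans ji _.
  by rewrite inE in iU.
have [f0 a0] := (entry0 gen true nE, entry0 gen false nE); rewrite /= in f0 a0.
by rewrite !mxE f0 a0 mulr0 subrr mulr0.
Qed.

End Necessity.

(** * The rank condition through left null vectors, and the theorem *)

Lemma controllable_null n (PF PA : pattern n) S Fv Av bv :
  generic_realization PF PA S Fv Av bv ->
  controllable_realization Fv Av bv <->
  (forall z (y : 'rV_n), y *m (cplx_mx Av - z *: cplx_mx Fv) = 0 ->
     (forall c, c \in S -> y 0 c = 0) -> y = 0).
Proof.
move=> [_ _ b0 _].
(* The input matrix scales entry [c] of [y] by [bv c], nonzero exactly on [S]; annihilating it means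
   vanishing on [S]. *)
have yB (y : 'rV_n) c : (y *m cplx_mx (diag_mx (\row_i bv i))) 0 c = y 0 c * ((bv c)%:C)%C.
  by rewrite /cplx_mx map_diag_mx mul_mx_diag !mxE.
split=> [ctr z y yD yS|null z].
  have /eqP free := ctr z; apply/eqP; rewrite -(mulmx_free_eq0 y free).
  apply/eqP; rewrite mul_mx_row yD -row_mx0; congr row_mx; apply/rowP => c.
  rewrite yB mxE; have [/yS->|] := boolP (c \in S); first by rewrite mul0r.
  by rewrite -b0 negbK => /eqP->; rewrite rmorph0 mulr0.
apply/eqP; apply: inj_row_free => y; rewrite mul_mx_row -row_mx0 => /eq_row_mx[yD yBc].
apply: (null z) => // c cS; have /rowP/(_ c)/eqP := yBc.
by rewrite yB mxE mulf_eq0 fmorph_eq0 => /orP[/eqP//|]; rewrite (negbTE (_ : bv c != 0)) ?b0.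
Qed.

(* M0 : any maximum matching of G_{A-sF}, used to compute its DM
   decomposition (which does not depend on this choice). *)
Theorem theorem2 (n : nat) (PF PA : pattern n) (M0 : {set 'I_n * 'I_n})
  (S : {set 'I_n}) :
  nu (pencil_graph PF PA) = n ->
  is_max_matching (pencil_graph PF PA) M0 ->
  input_configuration PF PA S <->
  exists (M : {set 'I_n * 'I_n}) (C : {set 'I_n}),
    [/\ is_max_matching PA M,
        (forall K, maximal_s_comp PF PA M0 K ->
           exists2 c, c \in C &
             dm_le (pencil_graph PF PA) M0 K (dm_comp (pencil_graph PF PA) M0 (inr c)))
      & (~: covered_rows M) :|: C \subset S].
Proof.
move=> nun maxM0; have [mu Emu M0mu] := perfect_matching_perm nun maxM0.
split=> [conf|[M [C [[mM _] cov]]]].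
  have [Fv [Av [bv real]]] := generic_realization_exists PF PA S.
  have gen := generic_realization_pencil real.
  have /(controllable_null real) null := conf _ _ _ real.
  have [|M maxM sub] := max_matching_cover gen (S := S).
    by move=> y yA; apply: (null 0); rewrite scale0r subr0.
  (* All of [S] serves as [C]. *)
  exists M, S; split=> //; last by rewrite subUset sub subxx.
  apply/(maximal_s_comp_cover Emu M0mu) => i j; exact: (s_arc_reached gen Emu null).
rewrite subUset => /andP[sub CS] Fv Av bv real.
apply/(controllable_null real) => z y yD yS.
apply: (null_vector_eq0 (generic_realization_pencil real) Emu mM sub _ yD yS) => i j pij rij.
have /(maximal_s_comp_cover Emu M0mu)/(_ i j pij rij)[c cC ci] := cov.
by exists c => //; apply: (subsetP CS).
Qed.
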